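(* Let $n\ge2$ and let $G$ be the free group on $u_1,\dots,u_n$. For real $a$ and $b$ define $\psi_{a,b}$ on $G$ by $$\psi_{a,b}(s)=a^{|s|-2\gamma(s)}\,b^{\gamma(s)}.$$ Then $\psi_{a,b}$ is positive definite if and only if $$-1\le a\le1\quad\text{and}\quad\frac{na^2-1}{n-1}\le b\le1.$$
   Context: For $s\in G$ (a reduced word in $u_1^{\pm1},\dots,u_n^{\pm1}$), $|s|$ is its length and $\gamma(s)$ is the number of positions where a letter $u_i^{-1}$ is immediately followed by a letter $u_j$ (number of negative-to-positive exponent changes from left to right). Convention $0^0=1$. *)

(* Defs.v *)
From HB Require Import structures.
From mathcomp Require Import all_boot all_order all_algebra.
From mathcomp Require Import complex reals.

Set Implicit Arguments.
Unset Strict Implicit.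
Unset Printing Implicit Defensive.

Import Order.TTheory GRing.Theory Num.Theory.

(* The letter (i, true) is u_i and (i, false) is u_i^-1. *)
Definition letter (n : nat) : Type := ('I_n * bool)%type.

Definition letter_inv n (x : letter n) : letter n := (x.1, ~~ x.2).

Definition reduced n (w : seq (letter n)) : bool :=
  sorted (fun x y => y != letter_inv x) w.

Record free_group (n : nat) : Type := FreeGroup {
  fg_word :> seq (letter n);
  fg_reduced : reduced fg_word
}.

HB.instance Definition _ n := [isSub for @fg_word n].
HB.instance Definition _ n := [Choice of free_group n by <:].

(* The reduced form of x :: w, for a reduced word w. *)
Definition push n (x : letter n) (w : seq (letter n)) : seq (letter n) :=
  if w is y :: w' then if y == letter_inv x then w' else x :: w else [:: x].

Section FreeGroupTheory.
Variable n : nat.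
Implicit Types (x y : letter n) (u v w : seq (letter n)) (s t : free_group n).

Lemma letter_invK : involutive (@letter_inv n).
Proof. by case=> i e; rewrite /letter_inv negbK. Qed.

Lemma letter_inv_neq x : x != letter_inv x.
Proof. by case: x => i e; rewrite /letter_inv xpair_eqE eqxx; case: e. Qed.

Lemma reduced_behead x w : reduced (x :: w) -> reduced w.
Proof. exact: path_sorted. Qed.

Lemma push_reduced x w : reduced w -> reduced (push x w).
Proof.
case: w => [|y w] //= yw; case: ifP => [_|xy]; first exact: (path_sorted yw).
by rewrite /reduced /= xy.
Qed.

Lemma foldr_push_reduced u w : reduced w -> reduced (foldr (@push n) w u).
Proof. by move=> rw; elim: u => //= x u; apply: push_reduced. Qed.

Lemma push_cons x w : reduced (x :: w) -> push x w = x :: w.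
Proof. by case: w => [|y w] //= /andP[/negPf->]. Qed.

Lemma foldr_push_nil w : reduced w -> foldr (@push n) [::] w = w.
Proof.
elim: w => //= x w IHw rxw.
by rewrite (IHw (reduced_behead rxw)) push_cons.
Qed.

Lemma pushK x w : reduced w -> push (letter_inv x) (push x w) = w.
Proof.
case: w => [|y w] /=; first by rewrite letter_invK eqxx.
case: eqP => [->|_] ryw; last by rewrite /= letter_invK eqxx.
by rewrite push_cons.
Qed.

Lemma foldr_push_push x v w : reduced v -> reduced w ->
  foldr (@push n) w (push x v) = push x (foldr (@push n) w v).
Proof.
case: v => [|y v] //= rv rw; case: eqP => //= ->.
rewrite -{1}[x]letter_invK pushK //; exact: foldr_push_reduced.
Qed.

Lemma foldr_push_assoc u v w : reduced v -> reduced w ->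
  foldr (@push n) w (foldr (@push n) v u) =
  foldr (@push n) (foldr (@push n) w v) u.
Proof.
move=> rv rw; elim: u => //= x u <-.
by rewrite foldr_push_push //; apply: foldr_push_reduced.
Qed.

Definition word_inv w : seq (letter n) := rev (map (@letter_inv n) w).

Lemma word_invK : involutive word_inv.
Proof.
move=> w; rewrite /word_inv map_rev revK -map_comp.
by rewrite (eq_map (g := id)) ?map_id // => x; apply: letter_invK.
Qed.

Lemma word_inv_reduced w : reduced w -> reduced (word_inv w).
Proof.
rewrite /reduced /word_inv rev_sorted sorted_map; apply: sub_sorted => x y /=.
by apply: contra => /eqP->; rewrite letter_invK.
Qed.

Lemma foldr_push_invl w v : reduced v ->
  foldr (@push n) v (word_inv w ++ w) = v.
Proof.
move=> rv; elim: w => //= x w IHw.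
rewrite /word_inv /= rev_cons cat_rcons !foldr_cat /= in IHw *.
by rewrite pushK //; apply: foldr_push_reduced.
Qed.

Definition fg_one : free_group n := @FreeGroup n [::] isT.

Definition fg_mul s t : free_group n :=
  FreeGroup (foldr_push_reduced s (fg_reduced t)).

Definition fg_inv s : free_group n :=
  FreeGroup (word_inv_reduced (fg_reduced s)).

Lemma fg_mulA : associative fg_mul.
Proof.
by move=> r s t; apply/val_inj; rewrite /= foldr_push_assoc ?fg_reduced.
Qed.

Lemma fg_mul1g : left_id fg_one fg_mul.
Proof. by move=> s; apply/val_inj. Qed.

Lemma fg_mulg1 : right_id fg_one fg_mul.
Proof. by move=> s; apply/val_inj/foldr_push_nil/fg_reduced. Qed.

Lemma fg_mulVg : left_inverse fg_one fg_inv fg_mul.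
Proof.
move=> s; apply/val_inj => /=.
by rewrite -{1}(foldr_push_nil (fg_reduced s)) -foldr_cat foldr_push_invl.
Qed.

Lemma fg_mulgV : right_inverse fg_one fg_inv fg_mul.
Proof.
move=> s; rewrite -{1}[s](_ : fg_inv (fg_inv s) = s) ?fg_mulVg //.
by apply/val_inj/word_invK.
Qed.

End FreeGroupTheory.

HB.instance Definition _ n := isGroup.Build (free_group n)
  (@fg_mulA n) (@fg_mul1g n) (@fg_mulg1 n) (@fg_mulVg n) (@fg_mulgV n).

Definition neg_to_pos n (s : free_group n) : nat :=
  count (fun p : letter n * letter n => ~~ p.1.2 && p.2.2)
        (zip s (behead s)).

Lemma neg_to_pos_le_size n (s : free_group n) : 2 * neg_to_pos s <= size s.
Proof.
rewrite /neg_to_pos; case: s => /= w _.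
have [m] := ubnP (size w); elim: m w => // m IHm [|x [|y w]] //= lt_wm.
have := IHm (y :: w) lt_wm; have := IHm w (ltnW lt_wm).
case: w {lt_wm} => [|z w] /=; first by rewrite addn0; case: (_ && _).
rewrite !mulnDr; case: x.2; case: y.2 => /= le1 le2; try exact: leqW.
by rewrite muln0 add0n (_ : 2 * true = 2) // add2n !ltnS.
Qed.

Local Open Scope ring_scope.

(* The order of C is partial: 0 <= z means that z is real and nonnegative. *)
Definition positive_definite (C : numClosedFieldType) (G : groupType)
    (phi : G -> C) : Prop :=
  forall (m : nat) (s : 'I_m -> G) (c : 'I_m -> C),
    0 <= \sum_(i < m) \sum_(j < m) c i * (c j)^* * phi ((s j)^-1 * s i)%g.

(* By neg_to_pos_le_size the subtraction of naturals does not truncate. *)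
Definition psi (R : realType) (n : nat) (a b : R) (s : free_group n) : R :=
  a ^+ (size s - 2 * neg_to_pos s) * b ^+ neg_to_pos s.

(* Main.v *)
Require Import Defs.
From mathcomp Require Import all_boot all_order all_algebra.
From mathcomp Require Import complex reals.
From mathcomp Require Import zify ring lra.
Import Order.TTheory GRing.Theory Num.Theory.
Local Open Scope ring_scope.

(* The Cayley graph is a tree of clusters {p, p u_1, ..., p u_n}, and psi(t^-1 s)
   is the product, over the clusters crossed by the geodesic from t to s, of a
   (from a parent p to a child p u_i or back) or b (between two children).
   Hence the kernel psi(t^-1 s) is glued from copies of one matrix on a
   cluster, along single points and with unit diagonal. Removing the rank one
   kernel psi(s) psi(t) makes the branches at 1 orthogonal; what remains on
   the branch of a letter x is a translate by x of a Schur complement of the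
   original kernel, plus, for the children u_i of 1, a scaled copy of the
   Schur complement (1 - b) I + (b - a^2) J of the cluster matrix. So the kernel
   is positive by induction on the size of its support as soon as
   1 - b >= 0 and 1 - b + n (b - a^2) >= 0. Conversely, test vectors supported
   on a cluster give the necessary conditions. *)

Set Implicit Arguments.
Unset Strict Implicit.
Unset Printing Implicit Defensive.

(** * Real positive semidefinite kernels *)

Section PositiveSemidefiniteKernels.
Variables (R : realFieldType) (T : Type).
Implicit Types (K : T -> T -> R) (f : T -> R).

(** Test vectors are lists of weighted points in which a point may recur, so pulling back along a
    non-injective map only maps the list. *)
Definition psd_kernel K : Prop := forall r : seq (R * T),
  0 <= \sum_(p <- r) \sum_(q <- r) p.1 * q.1 * K p.2 q.2.

Lemma eq_psd_kernel K K' : K =2 K' -> psd_kernel K -> psd_kernel K'.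
Proof.
move=> eqK psdK r; apply: le_trans (psdK r) _.
by under eq_bigr => p _ do under eq_bigr => q _ do rewrite eqK.
Qed.

Lemma psd_kernelD K K' :
  psd_kernel K -> psd_kernel K' -> psd_kernel (fun s t => K s t + K' s t).
Proof.
move=> psdK psdK' r; apply: le_trans (addr_ge0 (psdK r) (psdK' r)) _.
rewrite -big_split /=; under eq_bigr => p _ do rewrite -big_split /=.
by under eq_bigr => p _ do under eq_bigr => q _ do rewrite -mulrDr.
Qed.

Lemma psd_kernel_sum (I : Type) (e : seq I) (K : I -> T -> T -> R) :
  (forall i, psd_kernel (K i)) -> psd_kernel (fun s t => \sum_(i <- e) K i s t).
Proof.
move=> psdK; elim: e => [|i e IHe].
  move=> r; rewrite big1 // => p _; rewrite big1 // => q _.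
  by rewrite big_nil mulr0.
apply: eq_psd_kernel (psd_kernelD (psdK i) IHe) => s t.
by rewrite big_cons.
Qed.

Lemma psd_kernel_rank1 f : psd_kernel (fun s t => f s * f t).
Proof.
move=> r; rewrite (_ : \sum_(p <- r) _ = (\sum_(p <- r) p.1 * f p.2) ^+ 2).
  exact: sqr_ge0.
rewrite expr2 big_distrlr; apply: eq_bigr => p _; apply: eq_bigr => q _ /=.
by rewrite mulrACA.
Qed.

Lemma psd_kernelZ (c : R) K :
  0 <= c -> psd_kernel K -> psd_kernel (fun s t => c * K s t).
Proof.
move=> c_ge0 psdK r; apply: le_trans (mulr_ge0 c_ge0 (psdK r)) _.
rewrite mulr_sumr le_eqVlt; apply/orP; left; apply/eqP.
by apply: eq_bigr => p _; rewrite mulr_sumr; apply: eq_bigr => q _; ring.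
Qed.

Lemma psd_kernel_schur K p : (forall s t, K s t = K t s) -> K p p = 1 ->
  psd_kernel K -> psd_kernel (fun s t => K s t - K s p * K t p).
Proof.
move=> Ksym Kp psdK r; set z := \sum_(q <- r) q.1 * K q.2 p.
(* Since [K p p = 1], the coefficient [- z] at [p] minimizes the form, and the minimum is the form
   of the Schur complement. *)
have := psdK ((- z, p) :: r); rewrite !big_cons /=.
under [X in _ + X]eq_bigr => q _ do rewrite big_cons /=.
rewrite big_split /= Kp.
have -> : \sum_(q <- r) - z * q.1 * K p q.2 = - z * z.
  by rewrite mulr_sumr; apply: eq_bigr => q _; rewrite Ksym mulrA.
have -> : \sum_(q <- r) q.1 * - z * K q.2 p = - z * z.
  by rewrite mulr_sumr; apply: eq_bigr => q _; ring.
have -> : \sum_(s <- r) \sum_(t <- r)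
    s.1 * t.1 * (K s.2 t.2 - K s.2 p * K t.2 p) =
  \sum_(s <- r) \sum_(t <- r) s.1 * t.1 * K s.2 t.2 - z * z.
  rewrite big_distrlr /= -sumrB; apply: eq_bigr => s _.
  by rewrite -sumrB; apply: eq_bigr => t _; ring.
by congr (0 <= _); ring.
Qed.

End PositiveSemidefiniteKernels.

Lemma psd_kernel_pullback (R : realFieldType) (S T : Type) (K : T -> T -> R)
    (f : S -> R) (g : S -> T) :
  psd_kernel K -> psd_kernel (fun s t => f s * f t * K (g s) (g t)).
Proof.
move=> psdK r; apply: le_trans (psdK [seq (p.1 * f p.2, g p.2) | p <- r]) _.
rewrite big_map le_eqVlt; apply/orP; left; apply/eqP; apply: eq_bigr => p _.
by rewrite big_map; apply: eq_bigr => q _ /=; ring.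
Qed.

(** The matrix c I + d J splits as c (I - J/n) + (c + n d) J/n, a nonnegative combination of two
    orthogonal projections. *)
Lemma psd_kernel_delta (R : realFieldType) (n : nat) (c d : R) :
  (0 < n)%N -> 0 <= c -> 0 <= c + n%:R * d ->
  psd_kernel (fun k l : 'I_n => c * (k == l)%:R + d).
Proof.
move=> n_gt0 c_ge0 cd_ge0.
have nz : n%:R != 0 :> R by rewrite pnatr_eq0 -lt0n.
(* The projection P = I - J/n equals P P^T, hence is the sum of the rank one kernels of its
   columns. *)
have psd_centered := psd_kernel_sum (index_enum 'I_n) (fun m : 'I_n =>
  psd_kernel_rank1 (fun k : 'I_n => (k == m)%:R - n%:R^-1 : R)).
have psd_const : psd_kernel (fun _ _ : 'I_n => n%:R^-1 * (c + n%:R * d)).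
  have le0 : 0 <= n%:R^-1 * (c + n%:R * d) by rewrite mulr_ge0 ?invr_ge0.
  apply: eq_psd_kernel (psd_kernelZ le0 (psd_kernel_rank1 (fun=> 1))) => k l.
  by rewrite !mulr1.
apply: eq_psd_kernel (psd_kernelD (psd_kernelZ c_ge0 psd_centered) psd_const).
move=> k l.
have -> : \sum_(m < n) ((k == m)%:R - n%:R^-1) * ((l == m)%:R - n%:R^-1) =
    (k == l)%:R - n%:R^-1 :> R.
  under eq_bigr => m _ do rewrite mulrBl mulrBr mulrBr.
  rewrite !sumrB (bigD1 k) //= eqxx mul1r big1 ?addr0; last first.
    by move=> m /negPf; rewrite eq_sym => ->; rewrite mul0r.
  rewrite -mulr_suml -mulr_sumr.
  have sum1 (j : 'I_n) : \sum_(m < n) (j == m)%:R = 1 :> R.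
    rewrite (bigD1 j) //= eqxx big1 ?addr0 // => m /negPf.
    by rewrite eq_sym => ->.
  rewrite !sum1 sumr_const card_ord -mulr_natr eq_sym.
  by field.
by field.
Qed.

(** * Sign changes and cancellation in words *)

Section Words.
Variable n : nat.
Implicit Types (x y : letter n) (u v w : seq (letter n)) (s t : free_group n).

Definition letter_gen x : free_group n := @FreeGroup n [:: x] isT.

Definition neg_to_pos_word w : nat :=
  count (fun p : letter n * letter n => ~~ p.1.2 && p.2.2) (zip w (behead w)).

Lemma neg_to_posE s : neg_to_pos s = neg_to_pos_word s.
Proof. by []. Qed.

Lemma neg_to_pos_word_cat u x y v :
  neg_to_pos_word (rcons u x ++ y :: v) =
  (neg_to_pos_word (rcons u x) + (~~ x.2 && y.2) + neg_to_pos_word (y :: v))%N.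
Proof.
rewrite cat_rcons; elim: u => [|z [|z' u] IHu] //=.
  by rewrite /neg_to_pos_word /= in IHu *; rewrite -!addnA; congr addn.
by rewrite /neg_to_pos_word /= in IHu *; rewrite IHu -!addnA.
Qed.

(** Inversion both reverses the order and flips the signs, so a negative-to-positive change stays
    one. *)
Lemma neg_to_pos_word_inv w :
  neg_to_pos_word (word_inv w) = neg_to_pos_word w.
Proof.
elim: w => [|x [|y w] IHw] //.
have E z v : word_inv (z :: v) = rcons (word_inv v) (letter_inv z).
  by rewrite /word_inv /= rev_cons.
rewrite !E -[rcons (rcons _ _) _]cats1 neg_to_pos_word_cat -E IHw.
rewrite [in RHS]/neg_to_pos_word /= negbK addn0 addnC andbC.
by [].
Qed.

Lemma neg_to_pos_word_cons x w :
  x.2 -> neg_to_pos_word (x :: w) = neg_to_pos_word w.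
Proof. by case: w => [|y w] //; rewrite /neg_to_pos_word /= => ->. Qed.

Lemma fg_word_cancel x w s :
  fg_word s = x :: w -> fg_word ((letter_gen x)^-1 * s)%g = w.
Proof.
by move=> sE; rewrite /= sE /= letter_invK eqxx.
Qed.

Lemma fg_word_invM s t :
  (if fg_word s is x :: _ then
     if fg_word t is y :: _ then x != y else true else true) ->
  fg_word (t^-1 * s)%g = word_inv t ++ s.
Proof.
move=> neq_st; rewrite /= -[in LHS](foldr_push_nil (fg_reduced s)) -foldr_cat.
apply: foldr_push_nil; case sE: (fg_word s) neq_st => [|x v].
  by rewrite cats0 => _; apply/word_inv_reduced/fg_reduced.
case tE: (fg_word t) => [|y w] neq_xy.
  by have := fg_reduced s; rewrite sE.
have := word_inv_reduced (fg_reduced t); have := fg_reduced s.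
rewrite sE tE /word_inv /= rev_cons cat_rcons /reduced sorted_cat_cons.
by move=> /= -> ->; rewrite letter_invK neq_xy.
Qed.

Lemma size_word_inv w : size (word_inv w) = size w.
Proof. by rewrite size_rev size_map. Qed.

End Words.

(** * Factorization of psi(t^-1 s) according to the first letters *)

Section PsiKernel.
Variables (R : realType) (n : nat) (a b : R).
Implicit Types (x y : letter n) (s t g : free_group n).

Lemma psi_inv s : psi a b s^-1%g = psi a b s.
Proof.
by rewrite /psi !neg_to_posE /= neg_to_pos_word_inv size_word_inv.
Qed.

Lemma psi1 : psi a b (1%g : free_group n) = 1.
Proof. by rewrite /psi /neg_to_pos /= !expr0 mulr1. Qed.

Lemma psi_invMC s t : psi a b (t^-1 * s)%g = psi a b (s^-1 * t)%g.
Proof. by rewrite -psi_inv invgM invgK. Qed.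

(** A leading positive letter takes part in no sign change, so deleting it only shortens the word by
    one. *)
Lemma psi_positive_head x w s : fg_word s = x :: w -> x.2 ->
  psi a b s = a * psi a b ((letter_gen x)^-1 * s)%g.
Proof.
move=> sE x_pos; have := neg_to_pos_le_size ((letter_gen x)^-1 * s)%g.
rewrite /psi !neg_to_posE (fg_word_cancel sE) sE neg_to_pos_word_cons //= => le.
by rewrite subSn // exprS mulrA.
Qed.

(** Nothing cancels, and the junction of y^-1 with x is a sign change only when both x and y are
    positive; otherwise length and number of changes are additive. *)
Lemma psi_invM_distinct_heads s t :
  (if fg_word s is x :: _ then
     if fg_word t is y :: _ then (x != y) && ~~ (x.2 && y.2) else true
   else true) ->
  psi a b (t^-1 * s)%g = psi a b s * psi a b t.
Proof.
move=> heads; rewrite /psi !neg_to_posE fg_word_invM; last first.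
  by move: heads; case: fg_word => // x v; case: fg_word => // y w /andP[].
have -> : neg_to_pos_word (word_inv t ++ s) =
    (neg_to_pos_word s + neg_to_pos_word t)%N.
  rewrite -[neg_to_pos_word t]neg_to_pos_word_inv addnC.
  case: (fg_word s) heads => [|x v]; first by rewrite cats0 addn0.
  case: (fg_word t) => [|y w] // /andP[_].
  rewrite /word_inv /= rev_cons neg_to_pos_word_cat negbK andbC.
  by move=> /negbTE->; rewrite addn0.
rewrite size_cat size_word_inv mulrACA -!exprD; congr (_ ^+ _ * _).
have := neg_to_pos_le_size s; have := neg_to_pos_le_size t.
by rewrite !neg_to_posE; lia.
Qed.

(** The junction of y^-1 with x creates one sign change, and these two letters are exactly the
    length that it takes off the exponent of [a]. *)
Lemma psi_invM_positive_heads s t x y v w :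
  fg_word s = x :: v -> fg_word t = y :: w -> x.2 -> y.2 -> x != y ->
  psi a b (t^-1 * s)%g =
  b * (psi a b ((letter_gen x)^-1 * s)%g * psi a b ((letter_gen y)^-1 * t)%g).
Proof.
move=> sE tE x_pos y_pos neq_xy.
have := neg_to_pos_le_size ((letter_gen x)^-1 * s)%g.
have := neg_to_pos_le_size ((letter_gen y)^-1 * t)%g.
rewrite /psi !neg_to_posE (fg_word_cancel sE) (fg_word_cancel tE).
rewrite fg_word_invM ?sE ?tE // => le_w le_v.
have -> : neg_to_pos_word (word_inv (y :: w) ++ x :: v) =
    (neg_to_pos_word v + neg_to_pos_word w).+1.
  rewrite /word_inv /= rev_cons neg_to_pos_word_cat -rev_cons.
  rewrite -/(word_inv (y :: w)) neg_to_pos_word_inv !neg_to_pos_word_cons //=.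
  by rewrite negbK x_pos y_pos addn1 addSn addnC.
rewrite size_cat size_word_inv mulrACA -!exprD mulrCA -exprS.
by congr (_ ^+ _ * _); rewrite /=; lia.
Qed.

(** * Truncation by weight and the inductive decomposition *)

(* Charging u_i^-1 twice as much as u_i ensures that a word starting with u_i^-1
   is heavier than u_i, the base point seen from u_i^-1. *)
Definition letter_weight x : nat := if x.2 then 1 else 2.

Definition fg_weight s : nat := \sum_(x <- fg_word s) letter_weight x.

Definition truncated_kernel (N : nat) s t : R :=
  (fg_weight s <= N)%N%:R * (fg_weight t <= N)%N%:R * psi a b (t^-1 * s)%g.

Definition starts_with x s : bool := ohead (fg_word s) == Some x.

Lemma fg_weight_cancel x w s : fg_word s = x :: w ->
  fg_weight s = (letter_weight x + fg_weight ((letter_gen x)^-1 * s)%g)%N.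
Proof. by move=> sE; rewrite /fg_weight (fg_word_cancel sE) sE big_cons. Qed.

(* The point where the branch of x is attached to its cluster at the root, after
   translation by x^-1: for x = u_i this is u_i itself, since the siblings are
   treated separately by cluster_scale; for x = u_i^-1 it is the old root. *)
Definition attach_point x : free_group n :=
  if x.2 then 1%g else (letter_gen x)^-1%g.

Definition branch_kernel N x s t : R :=
  ((fg_weight s <= N.+1)%N && starts_with x s)%:R *
  ((fg_weight t <= N.+1)%N && starts_with x t)%:R *
  (psi a b (t^-1 * s)%g -
   psi a b ((attach_point x)^-1 * ((letter_gen x)^-1 * s))%g *
   psi a b ((attach_point x)^-1 * ((letter_gen x)^-1 * t))%g).

(** Translation by x^-1 lowers the weight by at least 1, so the branch of x within weight [N.+1]
    lands in the support of [truncated_kernel N], whose Schur complement at [attach_point x] is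
    pulled back. *)
Lemma psd_branch_kernel N x :
  psd_kernel (truncated_kernel N) -> psd_kernel (branch_kernel N x).
Proof.
move=> psdN; set p := attach_point x.
have wp : fg_weight p = (~~ x.2 : nat).
  rewrite /p /attach_point; case: ifP => x2 /=; rewrite /fg_weight /=.
    by rewrite big_nil.
  by rewrite big_cons big_nil /letter_weight /= x2.
have [wpN|wpN] := leqP (fg_weight p) N; last first.
  (* Here x is negative and N = 0: words starting with x weigh at least 2, so the kernel
     vanishes. *)
  move=> r; rewrite big1 // => q _; rewrite big1 // => q' _.
  rewrite /branch_kernel; case: (boolP (_ && starts_with x q.2)); last first.
    by move=> _; rewrite !mul0r mulr0.
  move=> /andP[wq]; rewrite /starts_with.
  case qE: (fg_word q.2) => [|y w] //= /eqP[yx].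
  move: wq wpN; rewrite wp (fg_weight_cancel qE) /letter_weight yx.
  by case: x.2 => //=; lia.
have Ksym s t : truncated_kernel N s t = truncated_kernel N t s.
  by rewrite /truncated_kernel psi_invMC [_%:R * _%:R]mulrC.
have Kp : truncated_kernel N p p = 1.
  by rewrite /truncated_kernel wpN mulVg psi1 !mulr1.
apply: eq_psd_kernel (psd_kernel_pullback
  (fun s => ((fg_weight s <= N.+1)%N && starts_with x s)%:R)
  (fun s => (letter_gen x)^-1 * s)%g (psd_kernel_schur Ksym Kp psdN)) => s t.
rewrite /branch_kernel -/p.
have wK (g : free_group n) : (fg_weight g <= N.+1)%N && starts_with x g ->
    (fg_weight ((letter_gen x)^-1 * g)%g <= N)%N.
  case/andP; rewrite /starts_with.
  case gE: (fg_word g) => [|y w] //= wg /eqP[yx].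
  move: wg; rewrite -yx (fg_weight_cancel gE) /letter_weight.
  by case: y.2; lia.
case: (boolP (_ && starts_with x s)) => [/wK ws|_]; last by rewrite !mul0r.
case: (boolP (_ && starts_with x t)) => [/wK wt|_]; last first.
  by rewrite !mulr0 !mul0r.
rewrite /truncated_kernel ws wt wpN !mul1r.
by rewrite invgM invgK -mulgA mulVKg.
Qed.

(** The factor of psi accumulated beyond the child u_i of the root; it is 0 outside the branches of
    the children. *)
Definition cluster_scale (N : nat) s : R :=
  if fg_word s is x :: _ then
    ((fg_weight s <= N.+1)%N && x.2)%:R * psi a b ((letter_gen x)^-1 * s)%g
  else 0.

(** The proof compares first letters. The default [(k0, true)] is read only at the empty word, where
    [cluster_scale] is 0. *)
Lemma truncated_kernelS (N : nat) (k0 : 'I_n) s t :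
  truncated_kernel N.+1 s t =
  ((fg_weight s <= N.+1)%N%:R * psi a b s) *
    ((fg_weight t <= N.+1)%N%:R * psi a b t) +
  cluster_scale N s * cluster_scale N t *
    ((1 - b) * ((head (k0, true) s).1 == (head (k0, true) t).1)%:R +
     (b - a ^+ 2)) +
  \sum_x branch_kernel N x s t.
Proof.
rewrite /truncated_kernel /cluster_scale /branch_kernel /starts_with.
case: (leqP (fg_weight s)) => _; last first.
  rewrite !mul0r big1 => [|x _]; last by rewrite !mul0r.
  by case: (fg_word s) => [|x v]; rewrite !mul0r !addr0.
case: (leqP (fg_weight t)) => _; last first.
  rewrite !(mul0r, mulr0) big1 => [|x _]; last by rewrite !(mul0r, mulr0).
  by case: (fg_word t) => [|y w]; rewrite !(mul0r, mulr0) !addr0.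
rewrite !mul1r.
(* No branch contains both words unless they share their first letter. *)
have sum0 : (if fg_word s is x :: _ then
     if fg_word t is y :: _ then x != y else true else true) ->
  \sum_x (true && (ohead s == Some x))%:R * (true && (ohead t == Some x))%:R *
    (psi a b (t^-1 * s)%g -
     psi a b ((attach_point x)^-1 * ((letter_gen x)^-1 * s))%g *
     psi a b ((attach_point x)^-1 * ((letter_gen x)^-1 * t))%g) = 0.
  move=> neq_st; rewrite big1 // => x _; apply/eqP; rewrite mulf_eq0.
  apply/orP; left; move: neq_st.
  case: (fg_word s) => [|z v] /=; first by rewrite mul0r.
  case: (fg_word t) => [|z' w] /=; first by rewrite mulr0.
  rewrite -natrM mulnb pnatr_eq0 eqb0; apply: contra => /andP[].
  by move=> /eqP[->] /eqP[->].
case sE: (fg_word s) sum0 => [|x v] sum0.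
  rewrite sum0 // mul0r mul0r !addr0.
  by apply: psi_invM_distinct_heads; rewrite sE.
case tE: (fg_word t) sum0 => [|y w] sum0.
  rewrite sum0 // mulr0 mul0r !addr0.
  by apply: psi_invM_distinct_heads; rewrite sE tE.
have [exy|neq_xy] := eqVneq x y; last first.
  rewrite sum0 // addr0 /=.
  have [/andP[x2 y2]|npos] := boolP (x.2 && y.2); last first.
    rewrite psi_invM_distinct_heads ?sE ?tE ?neq_xy //.
    case/nandP: npos => /negbTE->; first by rewrite !mul0r addr0.
    by rewrite mul0r mulr0 mul0r addr0.
  rewrite (psi_invM_positive_heads sE tE) // (psi_positive_head sE x2).
  rewrite (psi_positive_head tE y2) x2 y2.
  have -> : (x.1 == y.1) = false.
    apply: contra_neqF neq_xy => /eqP; case: x y {sE tE sum0} x2 y2.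
    by move=> i [] [j []] //= _ _ ->.
  by rewrite /= mulr0 !mul1r; ring.
case: y / exy {sum0} tE => tE.
rewrite (bigD1 x) //= !eqxx big1 ?addr0 => [|z]; last first.
  move=> /negPf neq_zx; rewrite (_ : (Some x == Some z) = false) ?mul0r //.
  by apply/negP => /eqP[exz]; rewrite exz eqxx in neq_zx.
(* The product subtracted in the branch is restored by the other terms: for positive x through a^2 +
   (1 - b) + (b - a^2) = 1, for negative x because it is psi(s) psi(t) itself. *)
rewrite /attach_point; have [x2|x2] := boolP x.2.
  rewrite invg1 !mul1g (psi_positive_head sE x2) (psi_positive_head tE x2).
  by rewrite /= !mul1r mulr1; ring.
by rewrite invgK !mulVKg !mul0r !mul1r; ring.
Qed.

Lemma psd_truncated_kernel (N : nat) : (0 < n)%N -> b <= 1 ->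
  0 <= 1 - b + n%:R * (b - a ^+ 2) -> psd_kernel (truncated_kernel N).
Proof.
move=> n_gt0 b_le1 ab_ge0; elim: N => [|N IHN].
  apply: eq_psd_kernel (psd_kernel_rank1
    (fun s : free_group n => (fg_weight s <= 0)%N%:R)) => s t.
  have w0 (g : free_group n) : (fg_weight g <= 0)%N -> g = 1%g.
    move=> wg; apply: val_inj; case gE: (fg_word g) => [|x v] /=; first by [].
    move: wg; rewrite (fg_weight_cancel gE) /letter_weight.
    by case: x.2.
  rewrite /truncated_kernel.
  case: (boolP (fg_weight s <= 0)%N) => [/w0->|]; last by rewrite !mul0r.
  case: (boolP (fg_weight t <= 0)%N) => [/w0->|]; last by rewrite mulr0 mul0r.
  by rewrite mulVg psi1 mulr1.
have subr_ge0b : 0 <= 1 - b by rewrite subr_ge0.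
have psd_cluster := psd_kernel_pullback (cluster_scale N)
  (fun s : free_group n => (head (Ordinal n_gt0, true) s).1)
  (psd_kernel_delta n_gt0 subr_ge0b ab_ge0).
have psd_branches := psd_kernel_sum (index_enum (letter n))
  (fun x => psd_branch_kernel x IHN).
apply: eq_psd_kernel (psd_kernelD (psd_kernelD (psd_kernel_rank1
  (fun s => (fg_weight s <= N.+1)%N%:R * psi a b s)) psd_cluster)
  psd_branches) => s t.
by rewrite (truncated_kernelS N (Ordinal n_gt0)).
Qed.

Lemma psd_psi_kernel : (0 < n)%N -> b <= 1 ->
  0 <= 1 - b + n%:R * (b - a ^+ 2) ->
  psd_kernel (fun s t : free_group n => psi a b (t^-1 * s)%g).
Proof.
(* A test list is finite, so truncating at its largest weight changes nothing on it. *)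
move=> n_gt0 b_le1 ab_ge0 r; set N := \max_(p <- r) fg_weight p.2.
apply: le_trans (psd_truncated_kernel N n_gt0 b_le1 ab_ge0 r) _.
rewrite le_eqVlt; apply/orP; left; apply/eqP.
have wN p : p \in r -> (fg_weight p.2 <= N)%N.
  by move=> pr; exact: (@leq_bigmax_seq _ r xpredT
    (fun q : R * free_group n => fg_weight q.2)).
apply: eq_big_seq => p pr; apply: eq_big_seq => q qr.
by rewrite /truncated_kernel !wN // !mul1r.
Qed.

(** * Necessity: test vectors on the cluster of the root *)

Lemma psd_psi_kernel_bounds : (1 < n)%N ->
  psd_kernel (fun s t : free_group n => psi a b (t^-1 * s)%g) ->
  [/\ -1 <= a, a <= 1, b <= 1 & 0 <= 1 - b + n%:R * (b - a ^+ 2)].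
Proof.
move=> n_gt1 psdK; pose u k := letter_gen (k, true) : free_group n.
have psi_u k : psi a b (u k) = a.
  by rewrite (@psi_positive_head (k, true) [::]) // mulVg psi1 mulr1.
have psi_uu k l : psi a b ((u k)^-1 * u l)%g = if k == l then 1 else b.
  have [->|neq_kl] := eqVneq k l; first by rewrite mulVg psi1.
  rewrite (@psi_invM_positive_heads _ _ (l, true) (k, true) [::] [::]) //.
    by rewrite !mulVg psi1 !mulr1.
  by apply: contra neq_kl => /eqP[->].
have psi_1u k : psi a b (1^-1 * u k)%g = a by rewrite invg1 mul1g.
have psi_u1 k : psi a b ((u k)^-1 * 1)%g = a by rewrite psi_invMC psi_1u.
pose k0 := Ordinal (ltnW n_gt1); pose k1 := Ordinal n_gt1.
have two_point c d g h := psdK [:: (c, g); (d, h)].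
split.
- have := two_point 1 1 1%g (u k0).
  by rewrite !big_cons !big_nil /= psi_u1 psi_1u psi_uu eqxx mulVg psi1; lra.
- have := two_point 1 (-1) 1%g (u k0).
  by rewrite !big_cons !big_nil /= psi_u1 psi_1u psi_uu eqxx mulVg psi1; lra.
- have := two_point 1 (-1) (u k0) (u k1).
  by rewrite !big_cons !big_nil /= !psi_uu !eqxx /=; lra.
(* With weight 1 at every u_k and x at the root the form is x^2 + 2 n a x + n + n (n - 1) b, minimal
   at x = - n a with value n (1 - b + n (b - a^2)). *)
have := psdK ((- n%:R * a, 1%g) :: [seq (1, u k) | k <- index_enum 'I_n]).
rewrite !big_cons /= mulVg psi1 !big_map /=.
under eq_bigr => k _ do rewrite psi_u1.
under [X in _ + X]eq_bigr => k _.
  rewrite big_cons big_map /= psi_1u.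
  under eq_bigr => l _ do rewrite !mul1r psi_uu.
  rewrite (bigD1 k) //= eqxx.
  under eq_bigr => l /negPf-> do over.
  rewrite sumr_const cardC1 card_ord.
  over.
rewrite !sumr_const card_ord.
rewrite -subn1 mulrnBr ?(ltnW n_gt1) //.
have n_gt0 : 0 < n%:R :> R by rewrite ltr0n ltnW.
rewrite -(pmulr_rge0 (1 - b + _) n_gt0) => Q_ge0; apply: le_trans Q_ge0 _.
by rewrite le_eqVlt; apply/orP; left; apply/eqP; ring.
Qed.

End PsiKernel.

(** * From complex coefficients to real ones, and the conclusion *)

Lemma positive_definite_psd_kernel (R : realType) (G : groupType) (f : G -> R) :
  (forall s, f s^-1%g = f s) ->
  positive_definite (fun s : G => (f s)%:C%C : R[i]) <->
  psd_kernel (fun s t => f (t^-1 * s)%g).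
Proof.
move=> fV; split=> [pd r|psd m s c].
  have := pd (size r) (fun i => (tnth (in_tuple r) i).2)
    (fun i => ((tnth (in_tuple r) i).1)%:C%C).
  rewrite (_ : \sum_i _ = (\sum_(p <- r) \sum_(q <- r)
      p.1 * q.1 * f (q.2^-1 * p.2)%g)%:C%C) ?lecR //.
  rewrite [in RHS]big_tnth rmorph_sum; apply: eq_bigr => i _.
  rewrite [in RHS]big_tnth rmorph_sum; apply: eq_bigr => j _.
  by rewrite !rmorphM /= -[(_ %:C%C)^*]/(_ %:C^*)%C conjc_real.
pose Q (x : 'I_m -> R) :=
  \sum_(i < m) \sum_(j < m) x i * x j * f ((s j)^-1 * s i)%g.
have Q_ge0 x : 0 <= Q x.
  apply: le_trans (psd [seq (x i, s i) | i <- index_enum 'I_m]) _.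
  rewrite big_map le_eqVlt; apply/orP; left; apply/eqP.
  by apply: eq_bigr => i _; rewrite big_map.
pose re i := complex.Re (c i); pose im i := complex.Im (c i).
(* Invariance of [f] under inversion makes the kernel symmetric, so the two mixed sums agree and the
   imaginary part [A - A] of the form vanishes. *)
pose A := \sum_(i < m) \sum_(j < m) im i * re j * f ((s j)^-1 * s i)%g.
have A_sym : A = \sum_(i < m) \sum_(j < m) re i * im j * f ((s j)^-1 * s i)%g.
  rewrite /A exchange_big; apply: eq_bigr => i _; apply: eq_bigr => j _.
  by rewrite [im _ * _]mulrC -fV invgM invgK.
suff -> : \sum_(i < m) \sum_(j < m)
    c i * (c j)^* * (f ((s j)^-1 * s i)%g)%:C%C = (Q re + Q im)%:C%C.
  by rewrite lecR addr_ge0.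
transitivity ((Q re + Q im)%:C + 'i * (A - A)%:C)%C; last first.
  by rewrite subrr mulr0 addr0.
rewrite {2}A_sym /Q /A -!big_split -sumrB /= !rmorph_sum mulr_sumr -big_split.
apply: eq_bigr => i _ /=.
rewrite -!big_split -sumrB /= !rmorph_sum mulr_sumr -big_split.
apply: eq_bigr => j _ /=; rewrite /re /im.
case: (c i) => x y; case: (c j) => x' y' /=.
by apply/eqP; rewrite eq_complex /=; apply/andP; split; apply/eqP; ring.
Qed.

Theorem proposition3p2 (R : realType) (n : nat) (n_ge2 : (2 <= n)%N) (a b : R) :
  positive_definite (fun s : free_group n => (psi a b s)%:C%C : R[i]) <->
  -1 <= a <= 1 /\ (n%:R * a ^+ 2 - 1) / (n%:R - 1) <= b <= 1.
Proof.
have n_gt1 : 0 < n%:R - 1 :> R by rewrite subr_gt0 ltr1n.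
(* Once n - 1 > 0 is cleared, the lower bound on [b] reads 0 <= 1 - b + n (b - a^2). *)
rewrite (positive_definite_psd_kernel (@psi_inv R n a b)) ler_pdivrMr //.
split=> [/(psd_psi_kernel_bounds n_ge2)[-> -> b_le1 ab]|[_ /andP[ab b_le1]]].
  by split=> //; apply/andP; split=> //; lra.
by apply: psd_psi_kernel => //; [exact: ltnW | lra].
Qed.
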